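(* Assume the Strong Polylog Conjecture holds (for every integer $m\geq 1$). Then for all integers $k>1$ and $q>1$, the $\varphi(q)+1$ real numbers $$1,\ \zeta(k,a/q)\quad (1\leq a<q,\ \gcd(a,q)=1)$$ are linearly independent over $\mathbb{Q}$.
   Context: For $0<x\leq 1$ and $\Re(s)>1$, the Hurwitz zeta function is $\zeta(s,x)=\sum_{n=0}^\infty (n+x)^{-s}$. $\varphi$ is Euler's totient function. For an integer $m\geq 1$ and complex $z$ with $|z|\leq 1$, the polylogarithm is $Li_m(z)=\sum_{n=1}^\infty z^n/n^m$. The Strong Polylog Conjecture (for a given $m$) asserts: if $\alpha_1,\dots,\alpha_n$ are algebraic numbers with $|\alpha_i|\leq 1$ for all $i$ such that $Li_m(\alpha_1),\dots,Li_m(\alpha_n)$ are linearly independent over $\mathbb{Q}$, then $1, Li_m(\alpha_1),\dots,Li_m(\alpha_n)$ are linearly independent over $\overline{\mathbb{Q}}$ (the algebraic numbers). *)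

(* Defs.v *)
From HB Require Import structures.
From mathcomp Require Import all_boot all_order all_algebra.
From mathcomp Require Import all_classical all_reals all_analysis.
From mathcomp Require Import complex.

Set Implicit Arguments.
Unset Strict Implicit.
Unset Printing Implicit Defensive.

Import Order.TTheory GRing.Theory Num.Theory.
Import numFieldNormedType.Exports.

Local Open Scope classical_set_scope.
Local Open Scope ring_scope.

(* R[i] only receives its topology through its numFieldType structure, so the
   sum is defined over an abstract numFieldType and instantiated at R[i].
   The value is meaningful only when the partial sums converge. *)
Definition infinite_sum (K : numFieldType) (u : nat -> K) : K :=
  limn (series u).

(* The index is shifted by one: sum over n >= 1 of z ^ n / n ^ m. *)
Definition polylog (R : realType) (m : nat) (z : R[i]) : R[i] :=
  infinite_sum (fun n => z ^+ n.+1 / n.+1%:R ^+ m).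

(* r ^ s = exp (s * ln r), for real r > 0 and complex s. *)
Definition cpow (R : realType) (r : R) (s : R[i]) : R[i] :=
  let t := complex.Im s * ln r in
  Complex (r `^ complex.Re s * cos t) (r `^ complex.Re s * sin t).

Definition hurwitz_zeta (R : realType) (s : R[i]) (x : R) : R[i] :=
  infinite_sum (fun n => cpow (n%:R + x) (- s)).

Definition rational_number (R : realType) : set R[i] := range ratr.

Definition algebraic_number (R : realType) : set R[i] :=
  [set z | algebraicOver (ratr : rat -> R[i]) z].

(* K is intended to be a subfield of F.  Since v is a family, a repeated value
   is a dependence. *)
Definition lin_indep_over (F : fieldType) (K : set F) (I : finType)
    (v : I -> F) : Prop :=
  forall c : I -> F,
    (forall i, K (c i)) -> \sum_i c i * v i = 0 -> forall i, c i = 0.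

Definition adjoin_one (F : fieldType) (I : finType) (v : I -> F) :
    option I -> F :=
  fun o => if o is Some i then v i else 1.

(* For m = 1 the point 1 is excluded: it is the only point of the closed unit
   disc at which the series of Li_1 diverges. *)
Definition strong_polylog_conjecture (R : realType) (m : nat) : Prop :=
  forall (n : nat) (alpha : 'I_n -> R[i]),
    (forall i, algebraic_number (alpha i)) ->
    (forall i, `|alpha i| <= 1) ->
    (m = 1%N -> forall i, alpha i != 1) ->
    lin_indep_over (@rational_number R) (fun i => polylog m (alpha i)) ->
    lin_indep_over (@algebraic_number R)
      (adjoin_one (fun i => polylog m (alpha i))).

(* Main.v *)
(* Put Z_r = sum of n^-k over n = r mod q, so that zeta(k, a/q) = q^k Z_a, and
   let w be a primitive q-th root of unity.  Fourier inversion mod q gives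
   q Z_m = sum_b w^(mb) Li_k(w^-b).  Expanding the Li_k(w^-b) in a Q-basis of
   their span, a rational relation between 1 and the zeta(k, a/q) becomes an
   algebraic relation between 1 and that basis, so by the conjecture each
   coefficient vanishes.  These coefficients are P_j(w) with P_j rational, hence
   P_j(w^h) = 0 as well for h prime to q, i.e. sum_a c_a Z_(ha) = 0 for all such
   h.  This system is diagonally dominant because Z_1 >= 1 and
   sum_r Z_r = zeta(k) < 2, whence c_a = 0. *)
Require Import Defs.
From mathcomp Require Import all_boot all_order all_algebra all_solvable all_field.
From mathcomp Require Import all_classical all_reals all_analysis.
From mathcomp Require Import complex lra ring zify.

Set Implicit Arguments.
Unset Strict Implicit.
Unset Printing Implicit Defensive.

Import Order.TTheory GRing.Theory Num.Theory.
Import numFieldNormedType.Exports.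

Local Open Scope classical_set_scope.
Local Open Scope ring_scope.

(** * Convergent series and their values *)

(** On a divergent series [limn] has no meaningful value, so convergence is carried along with the
    sum. *)
Definition has_sum (K : numFieldType) (u : nat -> K) (l : K) : Prop :=
  series u @ \oo --> l.

Lemma has_sumE (K : numFieldType) (u : nat -> K) (l : K) :
  has_sum u l -> infinite_sum u = l.
Proof. by move=> ul; apply/cvg_lim => //; exact: norm_hausdorff. Qed.

Lemma has_sumP (K : numFieldType) (u : nat -> K) (l : K) :
  has_sum u l <->
  forall e, 0 < e -> exists N : nat, forall n, (N <= n)%N ->
    `|l - \sum_(0 <= i < n) u i| < e.
Proof.
rewrite /has_sum; split=> [/cvgrPdist_lt ul e e0|ul].
  by have [N _ hN] := ul e e0; exists N => n; exact: hN.
apply/cvgrPdist_lt => e e0; have [N hN] := ul e e0.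
by exists N => // n; exact: hN.
Qed.

Lemma has_sumZ (K : numFieldType) (u : nat -> K) (l a : K) :
  has_sum u l -> has_sum (fun n => a * u n) (a * l).
Proof.
move=> ul; rewrite /has_sum.
have -> : series (fun n => a * u n) = (fun n => a * series u n).
  by apply/funext => n; rewrite /series /= mulr_sumr.
exact: cvgMr.
Qed.

Lemma has_sum_sum (K : numFieldType) (I : finType) (u : I -> nat -> K)
    (l : I -> K) :
  (forall i, has_sum (u i) (l i)) ->
  has_sum (fun n => \sum_i u i n) (\sum_i l i).
Proof.
move=> ul; rewrite /has_sum.
have -> : series (fun n => \sum_i u i n) = (fun n => \sum_i series (u i) n).
  by apply/funext => n; rewrite /series /= exchange_big.
rewrite -fct_sumE; apply: (big_ind2 (fun (f : nat -> K) x => f @ \oo --> x)).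
- exact: cvg_cst.
- by move=> f x g y; exact: cvgD.
- by move=> i _; exact: ul.
Qed.

Lemma has_sum_complex (R : realType) (u : nat -> R) (l : R) :
  has_sum u l -> has_sum (fun n => (u n)%:C%C) (l%:C)%C.
Proof.
move=> /has_sumP ul; apply/has_sumP => e e0.
(* A positive element of [R[i]] is real, so the complex tolerance is a real one. *)
have eE : e = ((complex.Re e)%:C)%C.
  by move: e0; case: e => a b; rewrite ltcE /= => /andP[/eqP ->].
have e1 : 0 < complex.Re e by rewrite -(ltcR 0) -eE.
have [N hN] := ul _ e1; exists N => n /hN; rewrite eE.
by rewrite -(rmorph_sum (real_complex R)) -rmorphB normc_def /= expr0n addr0
  sqrtr_sqr ltcR.
Qed.

(** * Zeta values restricted to residue classes *)

Lemma sum_inv_exp_le (R : realType) (k N : nat) : (1 < k)%N ->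
  \sum_(0 <= n < N) (n.+1%:R ^+ k)^-1 <= 7%:R / 4%:R :> R.
Proof.
move=> k1.
have sq n : ((n.+1%:R ^+ k)^-1 <= (n.+1%:R ^+ 2)^-1 :> R).
  by rewrite lef_pV2 ?posrE ?exprn_gt0// ler_weXn2l// ler1n.
(* The subtracted inverse makes the bound telescope; starting from two terms, 1 + 1/4 = 7/4 - 1/2,
   keeps the constant below 2. *)
have H M : \sum_(0 <= n < M.+2) (n.+1%:R ^+ k)^-1 <= 7%:R / 4%:R - M.+2%:R^-1 :> R.
  elim: M => [|M IH].
    rewrite !big_nat_recr //= big_nil add0r expr1n invr1.
    by have := sq 1%N; lra.
  rewrite big_nat_recr //=; apply: (le_trans (lerD IH (sq _))).
  have -> : M.+3%:R = M.+2%:R + 1 :> R by rewrite -natr1.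
  have : 0 < M.+2%:R :> R by [].
  move: (M.+2%:R) => x x0.
  have : ((x + 1) ^+ 2)^-1 <= x^-1 - (x + 1)^-1.
    have -> : x^-1 - (x + 1)^-1 = (x * (x + 1))^-1.
      by field; rewrite !gt_eqF//; lra.
    by rewrite lef_pV2 ?posrE; nra.
  lra.
apply: le_trans (_ : \sum_(0 <= n < N.+2) (n.+1%:R ^+ k)^-1 <= _).
  rewrite (@big_cat_nat _ _ _ N 0 N.+2) ?lerDl ?sumr_ge0//=; last lia.
apply: le_trans (H N) _.
by rewrite gerBl invr_ge0.
Qed.

(** Index [n] stands for the integer [n.+1]. Masking the other classes by 0 keeps all classes on one
    index set, so that they add up termwise. *)
Definition residue_term (R : realType) (q k r n : nat) : R :=
  (n.+1 == r %[mod q])%:R / n.+1%:R ^+ k.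

Definition residue_zeta (R : realType) (q k r : nat) : R :=
  infinite_sum (residue_term R q k r).

Section Residue.
Variables (R : realType) (q k : nat).
Hypotheses (k1 : (1 < k)%N) (q1 : (1 < q)%N).

Local Notation term := (residue_term R q k).
Local Notation Z := (residue_zeta R q k).

Lemma residue_term_ge0 r n : 0 <= term r n.
Proof. by rewrite divr_ge0. Qed.

Lemma residue_zeta_sum r : has_sum (term r) (Z r).
Proof.
rewrite /has_sum /residue_zeta /infinite_sum.
apply: nondecreasing_is_cvgn.
  by apply: nondecreasing_series => n _ _; exact: residue_term_ge0.
exists (7%:R / 4%:R) => _ [N _ <-].
apply: le_trans (sum_inv_exp_le R N k1).
rewrite /series /=; apply: ler_sum => n _.
rewrite /residue_term; case: (_ == _ %[mod _]); first by rewrite mul1r.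
by rewrite mul0r invr_ge0 exprn_ge0.
Qed.

Lemma residue_zeta_mod r s : r = s %[mod q] -> Z r = Z s.
Proof. by move=> rs; rewrite /residue_zeta /residue_term rs. Qed.

Lemma residue_zeta_ge0 r : 0 <= Z r.
Proof.
apply: limr_ge; first exact: cvgP _ (@residue_zeta_sum r).
by apply: nearW => n; rewrite /series /= sumr_ge0// => i _; exact: residue_term_ge0.
Qed.

Lemma residue_zeta1_ge1 : 1 <= Z 1.
Proof.
apply: limr_ge; first exact: cvgP _ (@residue_zeta_sum 1).
near=> n; rewrite /series /=.
have n0 : (0 < n)%N by near: n; exists 1%N.
rewrite (@big_cat_nat _ _ _ 1 0 n) //= big_nat1 /residue_term eqxx expr1n divr1.
by rewrite lerDl sumr_ge0// => i _; exact: residue_term_ge0.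
Unshelve. all: by end_near. Qed.

Lemma sum_eqmod_ord (V : pzSemiRingType) n (F : nat -> V) :
  \sum_(r < q) (n == r %[mod q])%:R * F r = F (n %% q)%N.
Proof.
have nq : (n %% q < q)%N by rewrite ltn_mod; lia.
rewrite (bigD1 (Ordinal nq)) //= modn_mod eqxx mul1r big1 ?addr0// => i inq.
rewrite (modn_small (ltn_ord i)); case: eqP => [e|]; last by rewrite mul0r.
by rewrite -val_eqE /= e eqxx in inq.
Qed.

(** Each positive integer lies in exactly one class, so the terms add up to those of the full
    series, whose partial sums are at most 7/4. *)
Lemma sum_residue_zeta_lt2 : \sum_(r < q) Z r < 2%:R.
Proof.
apply: (@le_lt_trans _ _ (7%:R / 4%:R)); last lra.
have h : has_sum (fun n => \sum_(r < q) term r n) (\sum_(r < q) Z r).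
  by apply: has_sum_sum => r; exact: residue_zeta_sum.
rewrite -(has_sumE h); apply: limr_le; first exact: cvgP _ h.
apply: nearW => N; apply: le_trans (sum_inv_exp_le R N k1).
rewrite /series /=; apply: ler_sum => n _.
by rewrite /residue_term (sum_eqmod_ord _ (fun=> _)).
Qed.

Lemma hurwitz_zetaE a : (0 < a < q)%N ->
  hurwitz_zeta k%:R (a%:R / q%:R) = ((q%:R ^+ k * Z a)%:C)%C :> R[i].
Proof.
move=> /andP[a0 aq].
have q0 : 0 < q%:R :> R by rewrite ltr0n; lia.
have -> : hurwitz_zeta k%:R (a%:R / q%:R) =
    infinite_sum (fun n => ((((n%:R + a%:R / q%:R : R) ^+ k)^-1)%:C)%C : R[i]).
  congr infinite_sum; apply/funext => n; rewrite /cpow.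
  have -> : - k%:R = ((- k%:R)%:C)%C :> R[i] by rewrite rmorphN rmorph_nat.
  rewrite /= mul0r cos0 sin0 mulr1 mulr0 powRN powR_mulrn.
    by [].
  by rewrite addr_ge0// divr_ge0.
apply: has_sumE; apply: has_sum_complex.
rewrite /has_sum.
(* Each block of [q] consecutive integers has exactly one member congruent to [a], so [N] Hurwitz
   terms match [N * q] masked terms. *)
have -> : series (fun n => ((n%:R + a%:R / q%:R) ^+ k)^-1) =
    (fun N => q%:R ^+ k * (series (term a) \o (fun N => N * q)%N) N) :> (R ^nat).
  apply/funext => N; rewrite /series /=.
  elim: N => [|N IH]; first by rewrite mul0n !big_nil mulr0.
  rewrite big_nat_recr //= IH mulSnr.
  rewrite [in RHS](@big_cat_nat _ _ _ (N * q)) //=; last lia.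
  rewrite mulrDr; congr (_ + _).
  rewrite -[X in \sum_(X <= _ < _) _](add0n (N * q)%N) big_addn addKn.
  rewrite (@big_cat_nat _ _ _ a.-1) //=; last lia.
  rewrite (@big_cat_nat _ _ _ a a.-1) //=; try lia.
  have zero i : (i < q)%N -> i != a.-1 -> term a (i + N * q) = 0.
    move=> iq ia; rewrite /residue_term -addSn.
    rewrite [X in (X %% _)%N == _]addnC modnMDl (modn_small aq).
    (* The last offset of a block stands for a multiple of [q]: its residue is 0, which differs from
       [a] as [a > 0]. *)
    have [iq'|iq'] := ltnP i.+1 q.
      by rewrite modn_small//; case: eqP => [e|]; rewrite ?mul0r//; lia.
    have -> : i.+1 = q by lia.
    by rewrite modnn; case: eqP => [e|]; rewrite ?mul0r//; lia.
  have zeroI m n : (n <= q)%N -> (n <= a.-1)%N || (a <= m)%N ->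
      \sum_(m <= i < n) term a (i + N * q) = 0.
    move=> nq na; rewrite big_nat_cond big1// => i /andP[/andP[mi i_n] _].
    by apply: zero; lia.
  rewrite (zeroI 0) ?(zeroI a) ?leqnn ?orbT//; last lia.
  rewrite add0r addr0 -[X in \sum_(_ <= _ < X) _](prednK a0) big_nat1
    /residue_term -addSn (prednK a0).
  rewrite [X in (X %% _)%N == _]addnC modnMDl eqxx mul1r -exprVn -exprVn -exprMn.
  congr (_ ^+ _).
  rewrite natrD natrM.
  have : a%:R + N%:R * q%:R != 0 :> R.
    by rewrite gt_eqF// ltr_pwDl ?ltr0n// mulr_ge0// ltW.
  by move=> h; field; rewrite h gt_eqF.
apply: cvgMr; apply: cvg_comp; last exact: residue_zeta_sum.
apply/cvgnyPge => M; exists M => // n /= Mn; lia || nia.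
Qed.

Lemma polylog_unity_root (v : R[i]) b : v ^+ q = 1 ->
  polylog k (v ^+ b) = \sum_(r < q) v ^+ (b * r) * ((Z r)%:C)%C.
Proof.
move=> vq; apply: has_sumE.
have -> : (fun n => (v ^+ b) ^+ n.+1 / n.+1%:R ^+ k) =
    (fun n => \sum_(r < q) v ^+ (b * r) * ((term r n)%:C)%C).
  apply/funext => n; under eq_bigr do rewrite rmorphM mulrA /= rmorph_nat.
  rewrite -mulr_suml; under eq_bigr do rewrite mulrC.
  rewrite (sum_eqmod_ord _ (fun r => v ^+ (b * r))).
  rewrite fmorphV rmorphXn /= rmorph_nat -exprM; congr (_ / _).
  rewrite {1}(divn_eq n.+1 q) mulnDr exprD.
  by rewrite [(_ * q)%N]mulnC mulnCA exprM vq expr1n mul1r.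
apply: has_sum_sum => r; apply: has_sumZ; apply: has_sum_complex.
exact: residue_zeta_sum.
Qed.

Lemma sum_polylog_unity_root (w : R[i]) m : q.-primitive_root w ->
  \sum_(b < q) w ^+ (m * b) * polylog k (w^-1 ^+ b) = q%:R * ((Z m)%:C)%C.
Proof.
move=> wp; have wq := prim_expr_order wp.
have w0 : w != 0.
  by apply/eqP => w0; move/eqP: wq; rewrite w0 expr0n gtn_eqF ?(ltnW q1)//
    eq_sym oner_eq0.
under eq_bigr => b _ do rewrite polylog_unity_root ?exprVn ?wq ?invr1// mulr_sumr.
rewrite exchange_big /=.
have E (r : 'I_q) : \sum_(b < q) w ^+ (m * b) * (w^-1 ^+ (b * r) * ((Z r)%:C)%C) =
   (m == r %[mod q])%:R * (q%:R * ((Z r)%:C)%C).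
  under eq_bigr => b _ do rewrite mulrA.
  rewrite -mulr_suml mulrA; congr (_ * _).
  (* Here [x] is [w^(m-r)]: its powers sum to [q] if [x = 1], and to 0 otherwise because
     [x ^+ q = 1]. *)
  set x := w ^+ m * w^-1 ^+ r.
  under eq_bigr => b _ do rewrite exprM (mulnC b) exprM -exprMn -/x.
  have xq : x ^+ q = 1.
    by rewrite exprMn -!exprM mulnC (mulnC r) !exprM exprVn wq invr1 !expr1n mulr1.
  have xE : (x == 1) = (m == r %[mod q]).
    rewrite /x exprVn -(eq_prim_root_expr wp).
    by rewrite -(inj_eq (mulIf (expf_neq0 r w0)) (w ^+ m / w ^+ r)) mulfVK
      ?mul1r ?expf_neq0.
  rewrite -xE; have [->|x1] := eqVneq x 1.
    by under eq_bigr do rewrite expr1n; rewrite sumr_const card_ord mul1r.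
  rewrite mul0r; apply/eqP; move: (subrX1 x q); rewrite xq subrr => /esym/eqP.
  by rewrite mulf_eq0 subr_eq0 (negbTE x1).
under eq_bigr do rewrite E.
rewrite (sum_eqmod_ord _ (fun r => q%:R * ((Z r)%:C)%C)).
by congr (_ * (_%:C)%C); apply: residue_zeta_mod; rewrite modn_mod.
Qed.

End Residue.

(** * Conjugates of a primitive root of unity *)

(* w is a root in C of the minimal polynomial of a primitive root z in algC:
   w and z annihilate the same rational polynomials, and in algC the
   irreducibility of cyclotomic polynomials is available. *)
Lemma conjugable_primitive_root_exists (C : numClosedFieldType) (q : nat) : (0 < q)%N ->
  exists2 w : C, q.-primitive_root w & algebraicOver (ratr : rat -> C) w /\
    forall (h : nat) (P : {poly rat}), coprime h q ->
      root (map_poly ratr P) w -> root (map_poly ratr P) (w ^+ h).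
Proof.
move=> q0; have [z zp] := C_prim_root_exists q0.
have [p [pz pm] pP] := minCpolyP z.
have p0 : p != 0 by exact: monic_neq0.
have rz P : root (map_poly (ratr : rat -> algC) P) z = (p %| P) by exact: pP.
have sp : size (map_poly (ratr : rat -> C) p) != 1%N.
  rewrite size_map_poly; apply/negP => /size_poly1P[c c0 pc].
  have := rz p; rewrite dvdpp pc map_polyC /= rootC => /eqP/eqP.
  by rewrite fmorph_eq0 (negbTE c0).
have [w rw] := closed_rootP _ sp.
have rwE P : root (map_poly (ratr : rat -> C) P) w = (p %| P).
  apply/idP/idP => [rPw|pP']; last first.
    by apply: root_dvdp rw; rewrite dvdp_map.
  (* Irreducibility of [p]: [z] is a root of the cofactor [e] or of the gcd, and in the first case
     [p %| e] makes the gcd constant, although it vanishes at [w]. *)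
  have : root (map_poly ratr (gcdp p P)) w by rewrite gcdp_map root_gcd rw.
  have /dvdpP[e pe] := dvdp_gcdl p P.
  have : root (map_poly (ratr : rat -> algC) p) z by rewrite rz.
  rewrite {1}pe rmorphM rootM !rz => /orP[pe'|/dvdp_trans]; last first.
    by move=> h _; apply: h; exact: dvdp_gcdr.
  have e0 : e != 0 by apply: contraNneq p0 => e0; rewrite pe e0 mul0r.
  have g0 : gcdp p P != 0 by rewrite gcdp_eq0 negb_and p0.
  have := dvdp_leq e0 pe'; rewrite {1}pe size_mul// -subn1 leq_subLR addnC
    leq_add2r => le_size.
  have s1 : (0 < size (gcdp p P))%N by rewrite size_poly_gt0.
  have /size_poly1P[c c0 ->] : size (gcdp p P) == 1%N by rewrite eqn_leq le_size.
  by rewrite map_polyC rootC fmorph_eq0 (negbTE c0).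
have wzE (n : nat) : (w ^+ n == 1) = (z ^+ n == 1).
  have := rwE ('X^n - 1); rewrite -rz !rmorphB !rmorphXn /= !map_polyX !rmorph1.
  by rewrite /root !hornerE !subr_eq0.
exists w; last split.
- apply/andP; split=> //; apply/forallP => i.
  by rewrite unity_rootE wzE -unity_rootE; case/andP: zp => _ /forallP/(_ i).
- by exists p.
move=> h P hq; rewrite rwE -rz => rPz.
have zhp : q.-primitive_root (z ^+ h) by rewrite prim_root_exp_coprime.
have rPzh : root (map_poly ratr P) (z ^+ h).
  (* Both minimal polynomials are the [q]-th cyclotomic polynomial. *)
  have [p' [pz' _] pP'] := minCpolyP (z ^+ h).
  have pp : p' = p.
    apply: (map_poly_inj (ratr : {rmorphism rat -> algC})).
    by rewrite -pz -pz' (minCpoly_cyclotomic zp) (minCpoly_cyclotomic zhp)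
      -(Cintr_Cyclotomic zp) (Cintr_Cyclotomic zhp).
  by rewrite pP' pp -rz.
(* Substituting [X^h] turns a root at an [h]-th power into a root at the base, where [w] and [z] are
   interchangeable. *)
have comp (F : numFieldType) (x : F) :
    root (map_poly ratr P) (x ^+ h) = root (map_poly ratr (P \Po 'X^h)) x.
  by rewrite map_comp_poly rmorphXn /= map_polyX /root horner_comp !hornerE.
by rewrite comp rwE -rz -comp.
Qed.

(** * Rational bases and algebraic numbers *)

(** Greedy selection along [l]. The basis consists of values of [v] itself, since the conjecture
    speaks of polylogarithm values and not of their combinations. *)
Lemma lin_basis_exists (F : numFieldType) (T : eqType) (v : T -> F) (l : seq T) :
  exists n (g : 'I_n -> T), (forall j, g j \in l) /\
    lin_indep_over (range (ratr : rat -> F)) (v \o g) /\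
    exists A : T -> 'I_n -> rat,
      forall x, x \in l -> v x = \sum_j ratr (A x j) * v (g j).
Proof.
elim: l => [|y l [n [g [gl [ind [A HA]]]]]].
  exists 0%N, (fun i : 'I_0 => match notF (valP i) with end).
  by split=> [[]|] //; split=> [c _ _ []|] //; exists (fun _ _ => 0).
have [[B HB]|nB] := pselect (exists B : 'I_n -> rat, v y = \sum_j ratr (B j) * v (g j)).
  exists n, g; split=> [j|]; first by rewrite inE gl orbT.
  split=> //; exists (fun x => if x == y then B else A x) => x.
  by rewrite inE; case: eqP => [->|_ /HA].
pose g' (i : 'I_n.+1) := oapp g y (unlift ord0 i).
have g'0 : g' ord0 = y by rewrite /g' unlift_none.
have g'S j : g' (lift ord0 j) = g j by rewrite /g' liftK.
exists n.+1, g'; split=> [j|].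
  by rewrite /g' inE; case: unliftP => [i|] _ /=; rewrite ?gl ?orbT ?eqxx.
split.
  move=> c cQ; rewrite big_ord_recl /= g'0; under eq_bigr do rewrite /= g'S.
  move=> H0.
  have c0 : c ord0 = 0.
    (* Otherwise division by [c ord0] puts [v y] in the span of the others, against [nB]. *)
    apply: contrapT => /eqP c0; apply: nB.
    have /choice[d dE] : forall i, exists d, ratr d = c i.
      by move=> i; have [d _ <-] := cQ i; exists d.
    exists (fun j => - d (lift ord0 j) / d ord0).
    under eq_bigr do rewrite fmorph_div rmorphN /= !dE mulrAC mulNr.
    rewrite -mulr_suml sumrN; move/eqP: H0; rewrite addrC addr_eq0 => /eqP ->.
    by rewrite opprK mulrC mulKf.
  move=> i; have [j ->|->] := unliftP ord0 i; last by [].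
  apply: (ind (fun j => c (lift ord0 j))) => [k|]; first exact: cQ.
  by move: H0; rewrite c0 mul0r add0r.
exists (fun x i => if x == y then (i == ord0)%:R else oapp (A x) 0 (unlift ord0 i)) => x.
rewrite inE; have [-> _|xy /= xl] := eqVneq x y.
  rewrite big_ord_recl big1 => [|j _].
    by rewrite rmorph1 mul1r addr0 g'0.
  by rewrite eq_sym (negbTE (neq_lift ord0 j)) rmorph0 mul0r.
rewrite big_ord_recl unlift_none /= rmorph0 mul0r add0r (HA _ xl).
by apply: eq_bigr => j _; rewrite liftK g'S.
Qed.

Lemma sum_option (V : nmodType) (I : finType) (F : option I -> V) :
  \sum_o F o = F None + \sum_i F (Some i).
Proof.
rewrite (bigD1 None) //=; congr (_ + _).
rewrite (reindex_omap Some id) //=; last by case.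
by apply: eq_bigl => i; rewrite eqxx.
Qed.

Lemma algebraicOver_horner (F E : fieldType) (f : {rmorphism F -> E})
    (p : {poly F}) (x : E) :
  algebraicOver f x -> algebraicOver f (map_poly f p).[x].
Proof.
move=> xalg; elim/poly_ind: p => [|p c IH].
  by rewrite rmorph0 horner0; exact: algebraic0.
rewrite rmorphD rmorphM /= map_polyX map_polyC hornerMXaddC.
by apply: algebraic_add (algebraic_id f c); exact: algebraic_mul.
Qed.

Lemma norm_unity_root (F : numDomainType) (x : F) (q : nat) : (0 < q)%N ->
  x ^+ q = 1 -> `|x| = 1.
Proof.
move=> q0 xq; apply/eqP; rewrite -(@pexpr_eq1 _ _ q)//.
by rewrite -normrX xq normr1.
Qed.

(** * Diagonal dominance over the units mod [q] *)

Local Notation unit_residue q := {a : 'I_q | (0 < a)%N && coprime a q}.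

(* The matrix Z (h * a) is diagonally dominant: each row contains Z 1 >= 1,
   and the remaining entries add up to less than 1. *)
Lemma residue_zeta_dominance (R : realType) (q k : nat)
    (x : unit_residue q -> R) : (1 < k)%N -> (1 < q)%N ->
  (forall h, coprime h q ->
    \sum_a x a * residue_zeta R q k (h * val a) = 0) ->
  forall a, x a = 0.
Proof.
move=> k1 q1 hx a0.
have q0 : (0 < q)%N by exact: ltnW.
have [b _ bmax] := @Order.TotalTheory.arg_maxP _ _ _ a0 xpredT (fun a => `|x a|) isT.
suff xb0 : x b = 0.
  by apply/eqP; rewrite -normr_le0 (le_trans (bmax a0 isT))// xb0 normr0.
apply/eqP; rewrite -normr_le0 leNgt; apply/negP => xb_gt0.
have [b0 bq] := andP (valP b).
(* By Euler's theorem [h] inverts [b] mod [q], so row [h] has [Z 1] in column [b], where the norm of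
   [x] is maximal. *)
pose h := ((val b) ^ (totient q).-1)%N.
have hq : coprime h q by exact: coprimeXl.
have hb : (h * val b)%N = 1 %[mod q].
  by rewrite /h -expnSr prednK ?totient_gt0// Euler_exp_totient.
(* Multiplication by [h] is injective on units, so the row has entries at distinct residues and its
   sum is below 2. *)
pose f (a : unit_residue q) := Ordinal (ltn_pmod (h * val a) q0).
have f_inj : injective f.
  have val_mod (a : unit_residue q) : val (val a) = (val b * (h * val a) %% q)%N.
    by rewrite mulnA [(val b * h)%N]mulnC -modnMml hb modnMml mul1n modn_small.
  move=> a a' [e]; apply/val_inj/val_inj; rewrite (val_mod a) (val_mod a').
  by rewrite -modnMmr e modnMmr.
have Zf (a : unit_residue q) : residue_zeta R q k (h * val a) = residue_zeta R q k (f a).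
  by apply: residue_zeta_mod; rewrite modn_mod.
have sumf : \sum_(a : unit_residue q) residue_zeta R q k (h * val a) < 2%:R.
  apply: le_lt_trans (sum_residue_zeta_lt2 R k1 q1).
  have -> : \sum_(a : unit_residue q) residue_zeta R q k (h * val a) =
      \sum_(r in f @: [set: unit_residue q]%SET) residue_zeta R q k r.
    rewrite big_imset /=; last exact: in2W.
    by apply: eq_big => [a|a _]; rewrite ?inE// Zf.
  rewrite big_mkcond /=.
  by apply: ler_sum => r _; case: ifP => // _; exact: residue_zeta_ge0.
have Zb : 1 <= residue_zeta R q k (h * val b).
  by rewrite (residue_zeta_mod _ _ hb); exact: residue_zeta1_ge1.
move: (hx h hq) sumf; rewrite (bigD1 b) //= => /eqP.
rewrite addr_eq0 => /eqP e; rewrite (bigD1 b) //= => lt2.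
have : `|x b| <= `|x b| * \sum_(a | a != b) residue_zeta R q k (h * val a).
  apply: (@le_trans _ _ `|x b * residue_zeta R q k (h * val b)|).
    by rewrite normrM ler_peMr// (le_trans Zb)// ler_norm.
  rewrite e normrN (le_trans (ler_norm_sum _ _ _))// mulr_sumr ler_sum// => a _.
  rewrite normrM [`|residue_zeta _ _ _ _|]ger0_norm ?residue_zeta_ge0//.
  by rewrite ler_wpM2r ?residue_zeta_ge0//; exact: bmax.
rewrite ler_pMr//; lra.
Qed.

(** * Transfer of a rational relation through the conjecture *)

Theorem theorem5 (R : realType)
  (SPC : forall m : nat, (1 <= m)%N -> strong_polylog_conjecture R m)
  (k q : nat) (hk : (1 < k)%N) (hq : (1 < q)%N) :
  lin_indep_over (@rational_number R)
    (adjoin_one (fun a : {a : 'I_q | (0 < a)%N && coprime a q} =>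
       hurwitz_zeta k%:R ((val a)%:R / q%:R))).
Proof.
move=> c cQ; rewrite sum_option /= mulr1 => rel.
have q0 : (0 < q)%N by exact: ltnW.
have /choice[x xE] : forall i, exists d, ratr d = c (Some i).
  by move=> i; have [d _ <-] := cQ (Some i); exists d.
have zetaE (a : unit_residue q) :
    hurwitz_zeta k%:R ((val a)%:R / q%:R) = ((q%:R ^+ k * residue_zeta R q k (val a))%:C)%C.
  by apply: hurwitz_zetaE => //; rewrite ltn_ord andbT; case/andP: (valP a).
have [w wp [walg wconj]] := conjugable_primitive_root_exists R[i] q0.
have wq := prim_expr_order wp.
have vq : w^-1 ^+ q = 1 by rewrite exprVn wq invr1.
pose L (b : 'I_q) : R[i] := polylog k (w^-1 ^+ b).
have [n [g [_ [indep [A LE]]]]] := lin_basis_exists L (enum 'I_q).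
(* At [w] this is the coefficient of [L (g j)] in the relation; Fourier inversion absorbs one factor
   of [q ^ k], hence [k.-1]. *)
pose P j : {poly rat} :=
  \sum_(a : unit_residue q) \sum_(b < q) (A b j * (q%:R ^+ k.-1 * x a)) *: 'X^(val a * b).
(* Evaluation at [w ^+ h] conjugates only the coefficients; the values [L (g j)] keep [w], so
   inversion yields the class of [h * a]. *)
have PE h : \sum_j (map_poly ratr (P j)).[w ^+ h] * L (g j) =
    \sum_(a : unit_residue q) c (Some a) * ((q%:R ^+ k * residue_zeta R q k (h * val a))%:C)%C.
  have PjE j : (map_poly ratr (P j)).[w ^+ h] * L (g j) =
      \sum_(a : unit_residue q) c (Some a) * (q%:R ^+ k.-1 *
        \sum_(b < q) w ^+ (h * val a * b) * (ratr (A b j) * L (g j))).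
    rewrite rmorph_sum horner_sum mulr_suml; apply: eq_bigr => a _.
    rewrite rmorph_sum horner_sum mulr_suml !mulr_sumr; apply: eq_bigr => b _.
    rewrite /= map_polyZ map_polyXn hornerZ hornerXn -exprM mulnA.
    rewrite !rmorphM rmorphXn /= rmorph_nat -xE; ring.
  under eq_bigr do rewrite PjE.
  rewrite exchange_big; apply: eq_bigr => a _; rewrite -mulr_sumr; congr (_ * _).
  rewrite -mulr_sumr exchange_big /=.
  under eq_bigr => b _ do rewrite -mulr_sumr -LE ?mem_enum//.
  rewrite (sum_polylog_unity_root hk hq _ wp) mulrA -exprSr prednK ?(ltnW hk)//.
  by rewrite rmorphM rmorphXn /= rmorph_nat.
have Li_indep := SPC _ (ltnW hk) _ (fun j => w^-1 ^+ g j).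
pose d o := if o is Some j then (map_poly ratr (P j)).[w] else c None.
have d0 : forall o, d o = 0.
  apply: Li_indep.
  - move=> j; elim: (nat_of_ord (g j)) => [|m IH]; first exact: algebraic1.
    by rewrite exprS; apply: algebraic_mul IH; exact: algebraic_inv.
  - by move=> j; rewrite (norm_unity_root q0)// exprAC vq expr1n.
  - by move=> e; move: hk; rewrite e.
  - exact: indep.
  - case=> [j|]; first exact: algebraicOver_horner.
    by rewrite /d; have [r _ <-] := cQ None; exact: algebraic_id.
  rewrite sum_option /= mulr1 -[RHS]rel; congr (_ + _).
  (* At [h = 1] the sum is the zeta part of the given relation. *)
  have := PE 1%N; rewrite expr1 => ->.
  by apply: eq_bigr => a _; rewrite mul1n zetaE.
have x0 : forall a, (ratr (x a) : R) = 0.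
  apply: (residue_zeta_dominance hk hq) => h hcop.
  have : \sum_(a : unit_residue q) c (Some a) * ((q%:R ^+ k * residue_zeta R q k (h * val a))%:C)%C = 0.
    rewrite -PE big1// => j _.
    have /rootP -> : root (map_poly ratr (P j)) (w ^+ h); last by rewrite mul0r.
    by apply: wconj => //; apply/rootP; exact: (d0 (Some j)).
  (* All terms are real, so the relation descends to [R], where [q ^ k] cancels. *)
  under eq_bigr do rewrite -xE -(fmorph_rat (real_complex R)) -rmorphM mulrCA.
  rewrite -(rmorph_sum (real_complex R)) -mulr_sumr => /eqP.
  rewrite fmorph_eq0 mulf_eq0 expf_eq0 pnatr_eq0 [q == _]gtn_eqF// andbF.
  by move=> /eqP.
case=> [a|]; last exact: (d0 None).
by rewrite -xE -(fmorph_rat (real_complex R)) x0 rmorph0.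
Qed.
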